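(* Extensional presentations of the minimally distributive ideal form $\operatorname{Idl}\to\mathbf{CRing}$ are naturally in bijection with functorial linear ring topologies. They are equivalently its strong extensional presentations. Explicitly, they are assignments $R\mapsto\mathcal N(R)$ such that $\mathcal N(R)$ is a filter of ideals of $R$ (the improper filter being allowed) and $$J\in\mathcal N(S),\quad f:R\to S\quad\Longrightarrow\quad f^{-1}(J)\in\mathcal N(R).$$ The kernel fibre $\mathcal N(R)$ is the filter of open ideals. A ring $R$ is Hausdorff for the extensional presentation if and only if its associated linear topology is separated, or equivalently Hausdorff.
   Context: **Size.** The base category $\mathcal C=\mathbf{CRing}$ (commutative rings with identity, including the zero ring, and identity-preserving homomorphisms) is treated as small relative to a suitable universe. **Forms.** A form over $\mathcal C$ with finite indexed meets is a faithful amnestic functor $p$ to $\mathcal C$ in which finite structured sources have initial lifts; equivalently a functor $F:\mathcal C^{\mathrm{op}}\to\mathbf{Meet}_\top$, where $\mathbf{Meet}_\top$ is the category of meet-semilattices with top and maps preserving finite meets (including top). Elements of $F_X$ are called clusters over $X$; $f^*:F_Y\to F_X$ is the action of $f:X\to Y$; $\top_X$ is the top of $F_X$. A structured sink over $X$ is a small family $(A_i,f_i)_{i}$ with $f_i:X_i\to X$ and $A_i\in F_{X_i}$. Its final lift, if it exists, is the least $U\in F_X$ with $A_i\le f_i^*U$ for all $i$; one writes $U=\nabla_i(A_i,f_i)$, and the whole datum (sink and $U$) is a final presentation. **Distributivity forms.** A distributivity form is a form $F$ with finite indexed meets together with a class of final presentations, called admissible, such that: (D1) every unit presentation $A=\nabla(A,1_X)$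 is admissible, and admissibility is invariant under bijective reindexing; (D2) if $U=\nabla_i(A_i,f_i)$ and $A_i=\nabla_j(B_{ij},g_{ij})$ (all $i$) are admissible, so is $U=\nabla_{i,j}(B_{ij},f_ig_{ij})$; (D3) if $U=\nabla_i(A_i,f_i)$ is admissible and $C\in F_X$, then $U\wedge C=\nabla_i(A_i\wedge f_i^*C,f_i)$ is an admissible final presentation. It is strong if moreover: (D4) for every admissible $U=\nabla_i(A_i,f_i)$ over $X$ and $h:Y\to X$, with pullbacks $h_i:Y_i\to X_i$, $f_i':Y_i\to Y$ of $f_i$ and $h$, $h^*U=\nabla_i(h_i^*A_i,f_i')$ is an admissible final presentation. Presentations are regarded up to isomorphism of their sources, i.e. $(A_i,f_i)$ may be replaced by $(\theta_i^*A_i,f_i\theta_i)$ with $\theta_i$ invertible. The minimal distributivity is the one in which only unit presentations $A=\nabla(A,1_X)$ are admissible (up to this convention). **Morphisms.** A morphism $u:F\to G$ of distributivity forms over $\mathcal C$ is a natural transformation with finite-meet-preserving components such that, for each admissible $U=\nabla_i(A_i,f_i)$ in $F$, $u_X(U)=\nabla_i(u_{X_i}(A_i),f_i)$ is an admissible final presentation in $G$. This gives the category $\mathbf{DFrm}(\mathcal C)$ and its full subcategory $\mathbf{SDFrm}(\mathcal C)$ of strong distributivity forms. **Extensional presentations.** A morphism $n:F\to G$ is null if $n_X(A)=\top_X$ for all $X$ and $A\in F_X$. A relative kernel of $u:F\to G$ is a morphism $k:K\to F$ with $uk$ null through which every $h:H\to F$ with $uh$ null factors uniquely; relative cokernels are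 defined dually. A pair $K\xrightarrow{k}F\xrightarrow{q}Q$ is short exact if $k$ is a kernel of $q$ and $q$ is a cokernel of $k$. An extensional presentation of $F$ is an isomorphism class, fixing $F$, of short exact sequences in $\mathbf{DFrm}(\mathcal C)$ with middle term $F$; a strong extensional presentation is the same notion in $\mathbf{SDFrm}(\mathcal C)$. Up to isomorphism the kernel term is identified with the subform with fibres $K_X=\{A\in F_X\mid q_X(A)=\top_X\}$ (the kernel fibres). If $F_X$ has a least cluster $\bot_X$, the object $X$ is Hausdorff for the extensional presentation if $\bot_X$ is the greatest lower bound of $K_X$ in $F_X$. **Ideal form.** $\operatorname{Idl}$ has as clusters over $R$ the ideals of $R$ ordered by inclusion, with $\top_R=R$, $\bot_R=0$, $I\wedge J=I\cap J$, $f^*J=f^{-1}(J)$. **Topologies.** A topological ring is linearly topologized if zero has a neighbourhood basis consisting of ideals. A functorial linear ring topology on $\mathbf{CRing}$ is a choice of such a topology on every ring for which every unital homomorphism is continuous. *)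

(* Defs.v *)
From HB Require Import structures.
From mathcomp Require Import all_boot all_order all_algebra.
From mathcomp Require Import boolp classical_sets filter topology.

Set Implicit Arguments.
Unset Strict Implicit.
Unset Printing Implicit Defensive.

Import Order.TTheory GRing.Theory.

Local Open Scope classical_set_scope.
Local Open Scope order_scope.

Record category := Category {
  obj :> Type;
  mor : obj -> obj -> Type;
  idmor : forall X, mor X X;
  compm : forall X Y Z, mor Y Z -> mor X Y -> mor X Z;
  compm_idl : forall X Y (f : mor X Y), compm (idmor Y) f = f;
  compm_idr : forall X Y (f : mor X Y), compm f (idmor X) = f;
  compm_assoc : forall X Y Z W (h : mor Z W) (g : mor Y Z) (f : mor X Y),
    compm h (compm g f) = compm (compm h g) f }.

Arguments mor {c} X Y.
Arguments idmor {c} X.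
Arguments compm {c X Y Z} g f.

Section CategoryNotions.
Variable C : category.

Definition is_iso (X Y : C) (f : mor X Y) : Prop :=
  exists g : mor Y X, compm g f = idmor X /\ compm f g = idmor Y.

Definition is_pullback (X Y Z P : C) (f : mor X Z) (g : mor Y Z)
    (p : mor P X) (q : mor P Y) : Prop :=
  compm f p = compm g q /\
  forall (T : C) (a : mor T X) (b : mor T Y), compm f a = compm g b ->
    exists! c : mor T P, compm p c = a /\ compm q c = b.

Definition full_subcategory (P : C -> Prop) : category :=
  @Category {X : C | P X} (fun X Y => mor (sval X) (sval Y))
    (fun X => idmor (sval X)) (fun X Y Z g f => compm g f)
    (fun X Y => @compm_idl C (sval X) (sval Y))
    (fun X Y => @compm_idr C (sval X) (sval Y))
    (fun X Y Z W => @compm_assoc C (sval X) (sval Y) (sval Z) (sval W)).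

Variable null : forall X Y : C, mor X Y -> Prop.

Definition is_kernel (K F Q : C) (k : mor K F) (u : mor F Q) : Prop :=
  null (compm u k) /\
  forall (H : C) (h : mor H F), null (compm u h) ->
    exists! h' : mor H K, compm k h' = h.

Definition is_cokernel (K F Q : C) (k : mor K F) (q : mor F Q) : Prop :=
  null (compm q k) /\
  forall (H : C) (h : mor F H), null (compm h k) ->
    exists! h' : mor Q H, compm h' q = h.

Variable F : C.

Record ext_sequence := ExtSequence {
  ker_obj : C;
  ker_map : mor ker_obj F;
  coker_obj : C;
  coker_map : mor F coker_obj }.

Definition short_exact (s : ext_sequence) : Prop :=
  is_kernel (ker_map s) (coker_map s) /\ is_cokernel (ker_map s) (coker_map s).

Definition sequence_iso (s t : ext_sequence) : Prop :=
  exists (a : mor (ker_obj s) (ker_obj t))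
         (b : mor (coker_obj s) (coker_obj t)),
    [/\ is_iso a, is_iso b, compm (ker_map t) a = ker_map s
      & compm b (coker_map s) = coker_map t].

(* An isomorphism class fixing F is encoded as the predicate of its members. *)
Definition presentation : Type :=
  {c : ext_sequence -> Prop | exists2 s, short_exact s &
     c = (fun t => short_exact t /\ sequence_iso s t)}.

End CategoryNotions.

Fact cluster_display : Order.disp_t. Proof. exact: (Order.Disp tt tt). Qed.

Record meet_form (C : category) := MeetForm {
  clus :> C -> tMeetSemilatticeType cluster_display;
  pull : forall X Y : C, mor X Y -> clus Y -> clus X;
  pull_meet : forall (X Y : C) (f : mor X Y) (A B : clus Y),
    pull f (A `&` B) = pull f A `&` pull f B;
  pull_top : forall (X Y : C) (f : mor X Y), pull f \top = \top;
  pull_id : forall (X : C) (A : clus X), pull (idmor X) A = A;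
  pull_comp : forall (X Y Z : C) (g : mor Y Z) (f : mor X Y) (A : clus Z),
    pull (compm g f) A = pull f (pull g A) }.

Arguments pull {C} F {X Y} f A : rename.

Section Sinks.
Variables (C : category) (F : meet_form C).

Record sink (X : C) := Sink {
  idx : Type;
  sdom : idx -> C;
  lab : forall i, F (sdom i);
  leg : forall i, mor (sdom i) X }.

Arguments sdom {X} s i.
Arguments lab {X} s i.
Arguments leg {X} s i.

Definition is_final_lift (X : C) (S : sink X) (U : F X) : Prop :=
  (forall i, lab S i <= pull F (leg S i) U) /\
  forall V : F X, (forall i, lab S i <= pull F (leg S i) V) -> U <= V.

Definition unit_sink (X : C) (A : F X) : sink X :=
  @Sink X unit (fun=> X) (fun=> A) (fun=> idmor X).

Definition reindex_sink (X : C) (S : sink X) (J : Type) (e : J -> idx S) :=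
  @Sink X J (fun j => sdom S (e j)) (fun j => lab S (e j))
    (fun j => leg S (e j)).

Definition reparam_sink (X : C) (S : sink X) (Z : idx S -> C)
    (theta : forall i, mor (Z i) (sdom S i)) :=
  @Sink X (idx S) Z (fun i => pull F (theta i) (lab S i))
    (fun i => compm (leg S i) (theta i)).

Definition comp_sink (X : C) (S : sink X) (T : forall i, sink (sdom S i)) :=
  @Sink X {i : idx S & idx (T i)} (fun p => sdom (T (projT1 p)) (projT2 p))
    (fun p => lab (T (projT1 p)) (projT2 p))
    (fun p => compm (leg S (projT1 p)) (leg (T (projT1 p)) (projT2 p))).

Definition restrict_sink (X : C) (S : sink X) (B : F X) :=
  @Sink X (idx S) (sdom S) (fun i => lab S i `&` pull F (leg S i) B) (leg S).

(* The sink (h_i^* A_i, f'_i)_i, for h_i : Y_i -> X_i and f'_i : Y_i -> Y. *)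
Definition pull_sink (X Y : C) (S : sink X) (P : idx S -> C)
    (h' : forall i, mor (P i) (sdom S i)) (f' : forall i, mor (P i) Y) :=
  @Sink Y (idx S) P (fun i => pull F (h' i) (lab S i)) f'.

End Sinks.

Arguments sdom {C F X} s i.
Arguments lab {C F X} s i.
Arguments leg {C F X} s i.

Definition map_sink (C : category) (F G : meet_form C) (u : forall X, F X -> G X)
    (X : C) (S : sink F X) : sink G X :=
  @Sink C G X (idx S) (sdom S) (fun i => u _ (lab S i)) (leg S).

Record dform (C : category) := DForm {
  dform_form :> meet_form C;
  adm : forall X : C, sink dform_form X -> dform_form X -> Prop;
  adm_final : forall (X : C) (S : sink dform_form X) (U : dform_form X),
    adm S U -> is_final_lift S U;
  adm_reparam : forall (X : C) (S : sink dform_form X) (U : dform_form X)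
      (Z : idx S -> C) (theta : forall i, mor (Z i) (sdom S i)),
    (forall i, is_iso (theta i)) -> adm S U -> adm (reparam_sink theta) U;
  adm_unit : forall (X : C) (A : dform_form X), adm (unit_sink A) A;
  adm_reindex : forall (X : C) (S : sink dform_form X) (U : dform_form X)
      (J : Type) (e : J -> idx S),
    bijective e -> adm S U -> adm (reindex_sink e) U;
  adm_comp : forall (X : C) (S : sink dform_form X) (U : dform_form X)
      (T : forall i, sink dform_form (sdom S i)),
    adm S U -> (forall i, adm (T i) (lab S i)) -> adm (comp_sink T) U;
  adm_meet : forall (X : C) (S : sink dform_form X) (U B : dform_form X),
    adm S U -> adm (restrict_sink S B) (U `&` B) }.

(* The pullbacks are arbitrary pullback squares rather than chosen ones; the two
   readings agree by [adm_reparam] when C has pullbacks. *)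
Definition strong (C : category) (F : dform C) : Prop :=
  forall (X Y : C) (S : sink F X) (U : F X) (h : mor Y X) (P : idx S -> C)
      (h' : forall i, mor (P i) (sdom S i)) (f' : forall i, mor (P i) Y),
    adm S U -> (forall i, is_pullback (leg S i) h (h' i) (f' i)) ->
    adm (pull_sink h' f') (pull F h U).

Record dmor (C : category) (F G : dform C) := DMor {
  dmor_fun :> forall X : C, F X -> G X;
  dmor_nat : forall (X Y : C) (f : mor X Y) (B : F Y),
    dmor_fun (pull F f B) = pull G f (dmor_fun B);
  dmor_meet : forall (X : C) (A B : F X),
    dmor_fun (A `&` B) = dmor_fun A `&` dmor_fun B;
  dmor_top : forall X : C, dmor_fun (\top : F X) = \top;
  dmor_adm : forall (X : C) (S : sink F X) (U : F X),
    adm S U -> adm (map_sink dmor_fun S) (dmor_fun U) }.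

Arguments dmor_fun {C F G} d {X} A : rename.

Section DFrm.
Variable C : category.

Lemma dmor_ext (F G : dform C) (u v : dmor F G) :
  (forall X (A : F X), u X A = v X A) -> u = v.
Proof.
case: u v => [u u1 u2 u3 u4] [v v1 v2 v3 v4] /= uv.
have E : u = v by apply: functional_extensionality_dep => X; apply: funext.
by case: _ / E v1 v2 v3 v4 {uv} => *; congr DMor; exact: Prop_irrelevance.
Qed.

Definition dmor_id (F : dform C) : dmor F F.
Proof. by exists (fun X A => A) => // X [I D L f] U. Defined.

Definition dmor_comp (F G H : dform C) (v : dmor G H) (u : dmor F G) : dmor F H.
Proof.
exists (fun X A => v X (u X A)) => [X Y f B|X A B|X|X S U SU].
- by rewrite !dmor_nat.
- by rewrite !dmor_meet.
- by rewrite !dmor_top.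
- exact: (dmor_adm v (dmor_adm u SU)).
Defined.

Definition DFrm : category.
Proof.
exists (dform C) (@dmor C) dmor_id dmor_comp => *; exact: dmor_ext.
Defined.

Definition SDFrm : category := @full_subcategory DFrm (@strong C).

Definition null_mor (F G : dform C) (u : dmor F G) : Prop :=
  forall X (A : F X), u X A = \top.

Definition null_strong (F G : SDFrm) (u : mor F G) : Prop := null_mor u.

Definition ext_presentation (F : DFrm) : Type :=
  @presentation DFrm null_mor F.

Definition strong_ext_presentation (F : SDFrm) : Type :=
  @presentation SDFrm null_strong F.

Definition forget_strong (F : SDFrm) (s : @ext_sequence SDFrm F) :
    @ext_sequence DFrm (sval F) :=
  @ExtSequence DFrm (sval F) (sval (ker_obj s)) (ker_map s)
    (sval (coker_obj s)) (coker_map s).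

Section KernelFibres.
Variables (F : DFrm) (s : @ext_sequence DFrm F).

Definition kernel_fibre (X : C) : set ((F : dform C) X) :=
  [set A | (coker_map s : dmor F _) X A = \top].

Arguments kernel_fibre X : clear implicits.

Definition hausdorff_object (X : C) : Prop :=
  exists2 bot, lbound setT bot & infimums (kernel_fibre X) bot.

End KernelFibres.

End DFrm.

Arguments kernel_fibre {C F} s X.
Arguments hausdorff_object {C F} s X.

Section Minimal.
Variables (C : category) (F : meet_form C).

(* Up to reindexing and isomorphism of the sources, a unit presentation is a
   one-element sink (theta^* U, theta) with theta invertible. *)
Definition min_adm (X : C) (S : sink F X) (U : F X) : Prop :=
  exists i0 : idx S, [/\ forall i, i = i0, is_iso (leg S i0)
    & lab S i0 = pull F (leg S i0) U].

Lemma iso_idmor (X : C) : is_iso (idmor X).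
Proof. by exists (idmor X); rewrite compm_idl. Qed.

Lemma iso_comp (X Y Z : C) (g : mor Y Z) (f : mor X Y) :
  is_iso g -> is_iso f -> is_iso (compm g f).
Proof.
move=> [g' [g'g gg']] [f' [f'f ff']]; exists (compm f' g'); split.
  by rewrite compm_assoc -(compm_assoc f' g' g) g'g compm_idr.
by rewrite compm_assoc -(compm_assoc g f f') ff' compm_idr.
Qed.

Lemma pull_mono (X Y : C) (f : mor X Y) (A B : F Y) :
  A <= B -> pull F f A <= pull F f B.
Proof. by move=> /meet_idPl AB; apply/meet_idPl; rewrite -pull_meet AB. Qed.

Lemma iso_pullback (X Y Z P : C) (f : mor X Z) (g : mor Y Z)
    (p : mor P X) (q : mor P Y) :
  is_pullback f g p q -> is_iso f -> is_iso q.
Proof.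
move=> [fp up] [f' [f'f ff']].
have [|c [[pc qc] _]] := up Y (compm f' g) (idmor Y).
  by rewrite compm_assoc ff' compm_idl compm_idr.
exists c; split=> //.
have [d [_ du]] := up P p q fp.
rewrite -(du (compm c q)) ?(du (idmor P)) ?compm_idr//.
split; last by rewrite compm_assoc qc compm_idl.
by rewrite compm_assoc pc -compm_assoc -fp compm_assoc f'f compm_idl.
Qed.

Lemma min_adm_final X (S : sink F X) U : min_adm S U -> is_final_lift S U.
Proof.
move=> [i0 [i0P [g [_ fg]] lE]]; split=> [i|V /(_ i0)]; first by rewrite (i0P i) lE.
by rewrite lE => /(pull_mono g); rewrite -!pull_comp fg !pull_id.
Qed.

Definition min_dform : dform C.
Proof.
exists F min_adm.
- exact: min_adm_final.
- move=> X S U Z theta thP [i0 [i0P fi lE]]; exists i0; split=> //=.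
    exact: iso_comp.
  by rewrite lE pull_comp.
- move=> X A; exists tt; split=> [[]//||/=]; first exact: iso_idmor.
  by rewrite pull_id.
- move=> X S U J e [e' ee' e'e] [i0 [i0P fi lE]]; exists (e' i0).
  split=> [j||] /=; first by rewrite -(i0P (e j)) ee'.
    by rewrite e'e.
  by rewrite e'e.
- move=> X S U T [i0 [i0P fi lE]] /(_ i0)[j0 [j0P gj lE']].
  exists (existT _ i0 j0); split=> [[i j]||] /=.
  + by have E := i0P i; subst i; rewrite (j0P j).
  + exact: iso_comp.
  + by rewrite lE' lE pull_comp.
- move=> X S U B [i0 [i0P fi lE]]; exists i0; split=> //=.
  by rewrite lE pull_meet.
Defined.

Lemma min_dform_strong : strong min_dform.
Proof.
move=> X Y S U h P h' f' [i0 [i0P fi lE]] pb; exists i0; split=> //=.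
  exact: (iso_pullback (pb i0)).
by rewrite lE -!pull_comp; case: (pb i0) => ->.
Qed.

End Minimal.

Section Rings.
Local Open Scope ring_scope.

Lemma rmorphism_ext (R S : comPzRingType) (f g : {rmorphism R -> S}) :
  f =1 g -> f = g.
Proof.
case: f g => [f [[f1] [f2]]] [g [[g1] [g2]]] /= fg.
have E : f = g by exact: funext.
case: _ / E g1 g2 {fg} => g1 g2.
by rewrite (Prop_irrelevance f1 g1) (Prop_irrelevance f2 g2).
Qed.

(* [comPzRingType] does not require 1 != 0: the zero ring is an object. *)
Definition CRing : category.
Proof.
exists comPzRingType (fun R S : comPzRingType => {rmorphism R -> S})
  (fun R : comPzRingType => (idfun : {rmorphism R -> R}))
  (fun (R S T : comPzRingType) (g : {rmorphism S -> T})
    (f : {rmorphism R -> S}) => (g \o f : {rmorphism R -> T}));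
by move=> *; exact: rmorphism_ext.
Defined.

Record ideal (R : comPzRingType) := Ideal {
  ideal_set :> set R;
  ideal0 : ideal_set 0;
  idealD : forall x y, ideal_set x -> ideal_set y -> ideal_set (x + y);
  idealM : forall a x, ideal_set x -> ideal_set (a * x) }.

Lemma ideal_ext (R : comPzRingType) (I J : ideal R) :
  ideal_set I = ideal_set J -> I = J.
Proof.
case: I J => [I i1 i2 i3] [J j1 j2 j3] /= E.
by case: _ / E j1 j2 j3 => *; congr Ideal; exact: Prop_irrelevance.
Qed.

HB.instance Definition _ (R : comPzRingType) := gen_eqMixin (ideal R).
HB.instance Definition _ (R : comPzRingType) := gen_choiceMixin (ideal R).

Definition ideal_le (R : comPzRingType) : rel (ideal R) :=
  fun I J => `[< I `<=` J >].

Lemma ideal_le_refl (R : comPzRingType) : reflexive (@ideal_le R).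
Proof. by move=> I; apply/asboolP. Qed.

Lemma ideal_le_anti (R : comPzRingType) : antisymmetric (@ideal_le R).
Proof.
move=> I J /andP[/asboolP IJ /asboolP JI].
by apply: ideal_ext; apply/seteqP.
Qed.

Lemma ideal_le_trans (R : comPzRingType) : transitive (@ideal_le R).
Proof.
by move=> J I K /asboolP IJ /asboolP JK; apply/asboolP; exact: subset_trans JK.
Qed.

HB.instance Definition _ (R : comPzRingType) :=
  @Order.Le_isPOrder.Build cluster_display (ideal R) (@ideal_le R)
    (@ideal_le_refl R) (@ideal_le_anti R) (@ideal_le_trans R).

Definition ideal_inter (R : comPzRingType) (I J : ideal R) : ideal R.
Proof.
exists (I `&` J)%classic => [|x y [? ?] [? ?]|a x [? ?]]; split;
  do ?[exact: ideal0|exact: idealD|exact: idealM].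
Defined.

Definition ideal_full (R : comPzRingType) : ideal R :=
  @Ideal R setT Logic.I (fun _ _ _ _ => Logic.I) (fun _ _ _ => Logic.I).

Lemma ideal_leI (R : comPzRingType) (I J K : ideal R) :
  (I <= ideal_inter J K)%O = (I <= J)%O && (I <= K)%O.
Proof.
apply/asboolP/andP => [IJK|[/asboolP IJ /asboolP IK] x Ix].
  by split; apply/asboolP => x /IJK[].
by split; [exact: IJ|exact: IK].
Qed.

Lemma ideal_lex1 (R : comPzRingType) (I : ideal R) : (I <= ideal_full R)%O.
Proof. exact/asboolP. Qed.

HB.instance Definition _ (R : comPzRingType) :=
  @Order.POrder_isMeetSemilattice.Build cluster_display (ideal R)
    (@ideal_inter R) (@ideal_leI R).

HB.instance Definition _ (R : comPzRingType) :=
  @Order.hasTop.Build cluster_display (ideal R)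
    (ideal_full R) (@ideal_lex1 R).

Definition ideal_preim (R S : comPzRingType) (f : {rmorphism R -> S})
    (J : ideal S) : ideal R.
Proof.
exists (f @^-1` J) => [|x y|a x] /=; rewrite ?rmorph0 ?rmorphD ?rmorphM.
- exact: ideal0.
- exact: idealD.
- exact: idealM.
Defined.

Definition Idl : meet_form CRing.
Proof.
exists (fun R : CRing => ideal R : tMeetSemilatticeType cluster_display)
  ideal_preim;
by move=> *; exact: ideal_ext.
Defined.

Definition Idl_min : DFrm CRing := min_dform Idl.

Definition Idl_min_strong : SDFrm CRing := exist _ Idl_min (@min_dform_strong _ Idl).

Record ideal_filters := IdealFilters {
  filt :> forall R : comPzRingType, set (ideal R);
  filt_top : forall R, filt (\top%O : ideal R);
  filt_meet : forall R (I J : ideal R),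
    filt I -> filt J -> filt (Order.meet I J);
  filt_up : forall R (I J : ideal R), filt I -> (I <= J)%O -> filt J;
  filt_preim : forall (R S : comPzRingType) (f : {rmorphism R -> S})
      (J : ideal S), filt J -> filt (ideal_preim f J) }.

Record topology_on (T : Type) := TopologyOn {
  opens : set (set T);
  opensT : opens setT;
  opensI : setI_closed opens;
  opens_bigU : forall (I : Type) (f : I -> set T),
    (forall i, opens (f i)) -> opens (\bigcup_i f i) }.

(* An alias of the carrier of R to which the topology t is attached, so that the
   library's [open], [nbhs], [continuous] and [hausdorff_space] refer to t. *)
Definition tring (R : comPzRingType) (t : topology_on R) : Type := R.

HB.instance Definition _ (R : comPzRingType) (t : topology_on R) :=
  GRing.ComPzRing.copy (tring t) R.

HB.instance Definition _ (R : comPzRingType) (t : topology_on R) :=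
  @isOpenTopological.Build (tring t) (opens t) (opensT t) (@opensI _ t)
    (@opens_bigU _ t).

Definition ring_topology (R : comPzRingType) (t : topology_on R) : Prop :=
  [/\ continuous (fun z : tring t * tring t => z.1 + z.2),
      continuous (fun z : tring t => - z)
    & continuous (fun z : tring t * tring t => z.1 * z.2)].

Definition linear_topology (R : comPzRingType) (t : topology_on R) : Prop :=
  forall A : set (tring t), nbhs (0 : tring t) A ->
    exists I : ideal R, nbhs (0 : tring t) I /\ I `<=` A.

Definition open_ideals (R : comPzRingType) (t : topology_on R) : set (ideal R) :=
  [set I | open (I : set (tring t))].

Definition separated_topology (R : comPzRingType) (t : topology_on R) : Prop :=
  \bigcap_(A in nbhs (0 : tring t)) A = [set 0].

Record linear_topologies := LinearTopologies {
  ltop :> forall R : comPzRingType, topology_on R;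
  ltop_ring : forall R, ring_topology (ltop R);
  ltop_linear : forall R, linear_topology (ltop R);
  ltop_continuous : forall (R S : comPzRingType) (f : {rmorphism R -> S}),
    continuous (f : tring (ltop R) -> tring (ltop S)) }.

End Rings.

(* Main.v *)
From HB Require Import structures.
Require Import Defs.
From mathcomp Require Import all_boot all_order all_algebra.
From mathcomp Require Import boolp classical_sets filter topology.

Set Implicit Arguments.
Unset Strict Implicit.
Unset Printing Implicit Defensive.

Import Order.TTheory.

Local Open Scope classical_set_scope.

(** Because only presentations by isomorphisms are admissible in the minimal
    distributivity on a form F, every natural family of finite-meet-preserving
    maps out of F is a morphism ([min_dmor]): admissibility is no constraint on
    maps out of F, and the classification is pure semilattice algebra.

    The clusters sent to top by a morphism form a filter in each fibre, and
    naturality makes these filters stable under inverse image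
    ([kernel_filter]). Conversely, given such a family N of filters, its
    inclusion in F and the projection of F onto the quotient that identifies
    clusters with the same trace on some member of N form a short exact
    sequence ([filter_sequence_exact]) whose kernel fibres are N again. For the
    cokernel property, a morphism that is top on N satisfies
    h A = h (A /\ n) for n in N, hence factors through the quotient; and the
    class of A is top exactly when n <= A for some n in N, that is when A is
    in N.

    In a short exact sequence each of the two maps determines the other by a
    universal property, so two sequences in which each quotient map kills the
    kernel of the other are isomorphic ([short_exact_iso]). For sequences with
    middle term F this says that the kernel fibres are a complete invariant.
    The terms of the sequence built from N carry minimal distributivities,
    which are strong, so the same argument runs unchanged among strong forms,
    and the strong classes correspond to the same families of filters.

    For ideals of commutative rings, a filter N(R) is a neighbourhood base of
    zero for a unique linear ring topology, whose open ideals are exactly N(R);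
    stability under inverse image is continuity of all homomorphisms. Both
    Hausdorff conditions say that the intersection of N(R) is zero. *)

(** * Short exact sequences and their isomorphism classes *)

Section ShortExact.
Variables (C : category) (null : forall X Y : C, mor X Y -> Prop).

(** Uniqueness in the universal property cancels a kernel map on the left. The
    premise that the composite is null stands for stability of null maps under
    composition, which this section assumes only further on. *)
Lemma is_kernel_inj (K F Q H : C) (k : mor K F) (u : mor F Q) (x y : mor H K) :
  is_kernel null k u -> null (compm (compm u k) y) ->
  compm k x = compm k y -> x = y.
Proof.
move=> [_ ku] uky E; have [|z [_ zu]] := ku H (compm k y).
  by rewrite compm_assoc.
by rewrite -(zu x E) (zu y erefl).
Qed.

Lemma is_cokernel_inj (K F Q H : C) (k : mor K F) (q : mor F Q) (x y : mor Q H) :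
  is_cokernel null k q -> null (compm y (compm q k)) ->
  compm x q = compm y q -> x = y.
Proof.
move=> [_ qk] ykq E; have [|z [_ zu]] := qk H (compm y q).
  by rewrite -compm_assoc.
by rewrite -(zu x E) (zu y erefl).
Qed.

Lemma kernel_iso (F K K' Q Q' : C) (k : mor K F) (k' : mor K' F)
    (u : mor F Q) (u' : mor F Q') :
  is_kernel null k u -> is_kernel null k' u' ->
  null (compm u k') -> null (compm u' k) ->
  exists2 a : mor K K', is_iso a & compm k' a = k.
Proof.
move=> kk kk' uk' u'k.
have [a [Ea _]] := kk'.2 _ _ u'k; have [b [Eb _]] := kk.2 _ _ uk'.
exists a => //; exists b; split.
  by apply: (is_kernel_inj kk); rewrite ?compm_idr ?compm_assoc ?Eb //; case: kk.
by apply: (is_kernel_inj kk'); rewrite ?compm_idr ?compm_assoc ?Ea //; case: kk'.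
Qed.

Lemma cokernel_iso (F K K' Q Q' : C) (k : mor K F) (k' : mor K' F)
    (q : mor F Q) (q' : mor F Q') :
  is_cokernel null k q -> is_cokernel null k' q' ->
  null (compm q k') -> null (compm q' k) ->
  exists2 b : mor Q Q', is_iso b & compm b q = q'.
Proof.
move=> qq qq' qk' q'k.
have [a [Ea _]] := qq.2 _ _ q'k; have [b [Eb _]] := qq'.2 _ _ qk'.
exists a => //; exists b; split.
  apply: (is_cokernel_inj qq); rewrite ?compm_idl -?compm_assoc ?Ea //.
  by case: qq.
apply: (is_cokernel_inj qq'); rewrite ?compm_idl -?compm_assoc ?Eb //.
by case: qq'.
Qed.

Variable F : C.
Implicit Types s t : ext_sequence F.

(** Each kernel map factors through the other, and dually for the quotient
    maps; the two factorizations are mutually inverse by uniqueness. Only the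
    two mixed composites have to be examined to compare two sequences. *)
Lemma short_exact_iso s t :
  short_exact null s -> short_exact null t ->
  null (compm (coker_map s) (ker_map t)) ->
  null (compm (coker_map t) (ker_map s)) -> sequence_iso s t.
Proof.
move=> [ks qs] [kt qt] st ts.
have [a ai aE] := kernel_iso ks kt st ts.
have [b bi bE] := cokernel_iso qs qt st ts.
by exists a, b.
Qed.

Hypothesis null_comp : forall (X Y Z W : C) (h : mor Z W) (u : mor Y Z)
  (f : mor X Y), null u -> null (compm h (compm u f)).

Lemma null_compl (X Y Z : C) (h : mor Y Z) (u : mor X Y) :
  null u -> null (compm h u).
Proof. by move=> nu; rewrite -(compm_idr u); exact: null_comp. Qed.

Lemma null_compr (X Y Z : C) (u : mor Y Z) (f : mor X Y) :
  null u -> null (compm u f).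
Proof. by move=> nu; rewrite -(compm_idl (compm u f)); exact: null_comp. Qed.

(** Exactness can be tested on one convenient member of an isomorphism class;
    this is what carries exactness from a full subcategory to the ambient
    category, where there are more test objects. *)
Lemma sequence_iso_exact s t :
  sequence_iso s t -> short_exact null t -> short_exact null s.
Proof.
case: s t => [K k Q q] [K' k' Q' q'].
case=> [/= a [b [[a' [a'a aa']] [b' [b'b bb']] /= ak bq]]].
case=> [[/= qk' kU] [_ /= qU]].
have bq' : compm b' q' = q by rewrite -bq compm_assoc b'b compm_idl.
have ak' : compm k a' = k' by rewrite -ak -compm_assoc aa' compm_idr.
have qk : null (compm q k).
  by rewrite -bq' -ak -compm_assoc (compm_assoc q'); exact: null_comp.
split; split=> //= H h.
- move=> /(null_compl b); rewrite compm_assoc bq => /kU[x [xE xU]].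
  exists (compm a' x); split=> [|y yE]; first by rewrite compm_assoc ak'.
  rewrite (xU (compm a y)) ?compm_assoc ?a'a ?compm_idl// ak; exact: yE.
- move=> /(null_compr a'); rewrite -compm_assoc ak' => /qU[x [xE xU]].
  exists (compm x b); split=> [|y yE]; first by rewrite -compm_assoc bq.
  rewrite (xU (compm y b')) -?compm_assoc ?b'b ?compm_idr// bq'; exact: yE.
Qed.

End ShortExact.

(** A full subcategory has fewer test objects for the universal properties,
    hence inherits exactness from the ambient category. *)
Lemma full_short_exact (C : category) (P : C -> Prop)
    (null : forall X Y : C, mor X Y -> Prop)
    (F K Q : full_subcategory P) (k : mor K F) (q : mor F Q) :
  @short_exact C null (sval F) (@ExtSequence C (sval F) (sval K) k (sval Q) q) ->
  @short_exact (full_subcategory P) (fun X Y f => @null (sval X) (sval Y) f) F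
    (ExtSequence k q).
Proof. by move=> [[qk kU] [_ qU]]; split; split=> //= H; [exact: kU|exact: qU]. Qed.

(** A complete invariant [phi] together with a section [can] of it with exact
    values turns isomorphism classes into a concrete type. Applied once to all
    forms and once to strong ones, with the same [T]. *)
Lemma presentation_classification (C : category)
    (null : forall X Y : C, mor X Y -> Prop) (F : C) (T : Type)
    (phi : ext_sequence F -> T) (can : T -> ext_sequence F) :
  (forall x, short_exact null (can x)) -> cancel can phi ->
  (forall s t, short_exact null s -> short_exact null t ->
     sequence_iso s t <-> phi s = phi t) ->
  exists f : presentation null F -> T, bijective f /\
    forall e s, sval e s <-> short_exact null s /\ f e = phi s.
Proof.
move=> canE canK isoE.
have class (s : ext_sequence F) : short_exact null s ->
    (fun t => short_exact null t /\ sequence_iso s t) =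
    (fun t => short_exact null t /\ phi s = phi t).
  move=> sE; apply/funext => t; apply/propext.
  by split=> -[tE /(isoE _ _ sE tE)].
have rep (e : presentation null F) : exists x : T,
    sval e = (fun t => short_exact null t /\ x = phi t).
  by case: e => c [s sE /= ->]; exists (phi s); exact: class.
have {rep} [f fE] := choice rep.
pose g x : presentation null F := exist _ _ (ex_intro2 _ _ _ (canE x) erefl).
have gE x : sval (g x) = (fun t => short_exact null t /\ x = phi t).
  by rewrite [LHS]class// canK.
have gK : cancel g f.
  move=> x; have : sval (g x) (can x) by rewrite gE; split; rewrite ?canK.
  by rewrite fE => -[_ ->]; exact: canK.
exists f; split=> [|e s]; last by rewrite fE.
exists g => // e; apply: eq_sig_hprop => [c|]; first exact: Prop_irrelevance.
by rewrite [RHS]fE; exact: gE.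
Qed.

(** * Quotients of a form by filters of clusters *)

Local Open Scope order_scope.

(** The possible families of kernel fibres. *)
Record filter_subform (C : category) (F : meet_form C) := FilterSubform {
  fsub :> forall X : C, set (F X);
  fsub_top : forall X, fsub (\top : F X);
  fsub_meet : forall X (A B : F X), fsub A -> fsub B -> fsub (A `&` B);
  fsub_up : forall X (A B : F X), fsub A -> A <= B -> fsub B;
  fsub_pull : forall (X Y : C) (f : mor X Y) (B : F Y),
    fsub B -> fsub (pull F f B) }.

Section Subform.
Variables (C : category) (F : meet_form C) (N : filter_subform F).

Record fsub_clus (X : C) := FsubClus { fsub_val : F X; fsub_valP : N X fsub_val }.

Lemma fsub_val_inj X : injective (@fsub_val X).
Proof.
by case=> A nA [B nB] /= E; subst B; congr FsubClus; exact: Prop_irrelevance.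
Qed.

HB.instance Definition _ X := gen_eqMixin (fsub_clus X).
HB.instance Definition _ X := gen_choiceMixin (fsub_clus X).

Definition fsub_le X : rel (fsub_clus X) := fun A B => fsub_val A <= fsub_val B.

Lemma fsub_le_refl X : reflexive (@fsub_le X).
Proof. by move=> A; exact: lexx. Qed.

Lemma fsub_le_anti X : antisymmetric (@fsub_le X).
Proof. by move=> A B AB; apply: fsub_val_inj; exact: le_anti. Qed.

Lemma fsub_le_trans X : transitive (@fsub_le X).
Proof. by move=> B A D; exact: le_trans. Qed.

HB.instance Definition _ X :=
  @Order.Le_isPOrder.Build cluster_display (fsub_clus X) (@fsub_le X)
    (@fsub_le_refl X) (@fsub_le_anti X) (@fsub_le_trans X).

Definition fsub_inter X (A B : fsub_clus X) : fsub_clus X :=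
  FsubClus (fsub_meet (fsub_valP A) (fsub_valP B)).

Lemma fsub_leI X (A B D : fsub_clus X) :
  (A <= fsub_inter B D) = (A <= B) && (A <= D).
Proof. exact: lexI. Qed.

Lemma fsub_lex1 X (A : fsub_clus X) : A <= FsubClus (fsub_top N X).
Proof. exact: lex1. Qed.

HB.instance Definition _ X :=
  @Order.POrder_isMeetSemilattice.Build cluster_display (fsub_clus X)
    (@fsub_inter X) (@fsub_leI X).

HB.instance Definition _ X :=
  @Order.hasTop.Build cluster_display (fsub_clus X) _ (@fsub_lex1 X).

Definition subform : meet_form C.
Proof.
exists (fun X => fsub_clus X : tMeetSemilatticeType cluster_display)
  (fun X Y f B => FsubClus (fsub_pull f (fsub_valP B)));
by move=> *; apply: fsub_val_inj;
  rewrite /= ?pull_meet ?pull_top ?pull_id ?pull_comp.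
Defined.

End Subform.

Section QuotientForm.
Variables (C : category) (F : meet_form C) (N : filter_subform F).

(** The least congruence that makes the members of N top: in a meet
    semilattice, two clusters become equal as soon as they have the same trace
    on some member of the filter. *)
Definition quot_eq (X : C) : rel (F X) :=
  fun A B => `[< exists2 n, N X n & A `&` n = B `&` n >].

Lemma quot_eq_refl X : reflexive (@quot_eq X).
Proof. by move=> A; apply/asboolP; exists \top => //; exact: fsub_top. Qed.

Lemma quot_eq_sym X : symmetric (@quot_eq X).
Proof. by move=> A B; apply/asboolP/asboolP => -[n nN E]; exists n. Qed.

Lemma quot_eq_trans X : transitive (@quot_eq X).
Proof.
move=> B A D /asboolP[n nN AB] /asboolP[m mN BD]; apply/asboolP.
exists (n `&` m); first exact: fsub_meet.
by rewrite meetA AB meetAC BD meetAC -meetA.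
Qed.

Canonical quot_equiv X :=
  EquivRel (@quot_eq X) (@quot_eq_refl X) (@quot_eq_sym X) (@quot_eq_trans X).

Definition quot_clus (X : C) := {eq_quot (@quot_eq X)}%qT.

HB.instance Definition _ X := Choice.on (quot_clus X).

Definition quot_class X (A : F X) : quot_clus X := (\pi_(quot_clus X) A)%qT.

Lemma quot_classP X (A B : F X) :
  quot_class A = quot_class B <-> exists2 n, N X n & A `&` n = B `&` n.
Proof.
split; first by move/eqmodP => /asboolP.
by move=> AB; apply/eqmodP/asboolP.
Qed.

Lemma quot_class_surj X (a : quot_clus X) : exists A, quot_class A = a.
Proof. by exists (repr a); exact: reprK. Qed.


Definition quot_repr X (a : quot_clus X) : F X := repr a.

Lemma quot_reprK X (a : quot_clus X) : quot_class (quot_repr a) = a.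
Proof. exact: reprK. Qed.

Lemma quot_reprP X (A : F X) :
  exists2 n, N X n & quot_repr (quot_class A) `&` n = A `&` n.
Proof. by apply/quot_classP; exact: quot_reprK. Qed.

Definition quot_le X : rel (quot_clus X) :=
  fun a b => `[< exists2 n, N X n & quot_repr a `&` n <= quot_repr b >].

Lemma meetr_le X (A B k : F X) : (A `&` k <= B `&` k) = (A `&` k <= B).
Proof. by rewrite lexI leIr andbT. Qed.

Lemma meet_eq_shrink X (A B n k : F X) :
  A `&` n = B `&` n -> k <= n -> A `&` k = B `&` k.
Proof. by move=> E /meet_idPl <-; rewrite ![k `&` n]meetC !meetA E. Qed.

(** The order of the quotient is computed on arbitrary representatives, because
    one member of N can be chosen small enough to make both of them agree with
    the chosen ones. *)
Lemma quot_le_class X (A B : F X) :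
  quot_le (quot_class A) (quot_class B) <-> exists2 n, N X n & A `&` n <= B.
Proof.
have [m mN Am] := quot_reprP A; have [p pN Bp] := quot_reprP B.
have mpN : N X (m `&` p) by exact: fsub_meet.
have key n : quot_repr (quot_class A) `&` (n `&` (m `&` p)) <= quot_repr (quot_class B) =
    (A `&` (n `&` (m `&` p)) <= B).
  set k := n `&` _; have km : k <= m by rewrite /k meetCA leIl.
  have kp : k <= p by rewrite /k meetA leIr.
  rewrite -meetr_le (meet_eq_shrink Am km) (meet_eq_shrink Bp kp).
  exact: meetr_le.
have shrink n (D : F X) : D `&` (n `&` (m `&` p)) <= D `&` n.
  by rewrite meetA leIl.
split=> [/asboolP|] [n nN le]; last apply/asboolP.
  by exists (n `&` (m `&` p)); [exact: fsub_meet|rewrite -key (le_trans _ le)].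
by exists (n `&` (m `&` p)); [exact: fsub_meet|rewrite key (le_trans _ le)].
Qed.

Lemma quot_le_refl X : reflexive (@quot_le X).
Proof. by move=> a; apply/asboolP; exists \top; [exact: fsub_top|exact: leIl]. Qed.

Lemma quot_le_anti X : antisymmetric (@quot_le X).
Proof.
move=> a b /andP[/asboolP[n nN ab] /asboolP[m mN ba]].
rewrite -(quot_reprK a) -(quot_reprK b); apply/quot_classP.
exists (n `&` m); first exact: fsub_meet.
apply/le_anti; rewrite !meetr_le.
rewrite (le_trans _ ab) ?(le_trans _ ba)//; apply: leI2 => //.
  exact: leIr.
exact: leIl.
Qed.

Lemma quot_le_trans X : transitive (@quot_le X).
Proof.
move=> b a d /asboolP[n nN ab] /asboolP[m mN bd]; apply/asboolP.
exists (n `&` m); first exact: fsub_meet.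
by rewrite meetA (le_trans _ bd)// leI2.
Qed.

HB.instance Definition _ X :=
  @Order.Le_isPOrder.Build cluster_display (quot_clus X) (@quot_le X)
    (@quot_le_refl X) (@quot_le_anti X) (@quot_le_trans X).

Lemma quot_leP X (A B : F X) :
  quot_class A <= quot_class B <-> exists2 n, N X n & A `&` n <= B.
Proof. exact: quot_le_class. Qed.

Definition quot_inter X (a b : quot_clus X) : quot_clus X :=
  quot_class (quot_repr a `&` quot_repr b).

Lemma quot_leI X (a b d : quot_clus X) :
  (a <= quot_inter b d) = (a <= b) && (a <= d).
Proof.
rewrite -(quot_reprK a) -{2}(quot_reprK b) -{2}(quot_reprK d).
apply/idP/andP => [/quot_leP[n nN]|[/quot_leP[n nN ab] /quot_leP[m mN ad]]].
  by rewrite lexI => /andP[ab ad]; split; apply/quot_leP; exists n.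
apply/quot_leP; exists (n `&` m); first exact: fsub_meet.
rewrite lexI (le_trans _ ab) ?(le_trans _ ad)//; apply: leI2 => //.
  exact: leIr.
exact: leIl.
Qed.

Lemma quot_lex1 X (a : quot_clus X) : a <= quot_class (\top : F X).
Proof.
rewrite -(quot_reprK a); apply/quot_leP.
by exists \top; [exact: fsub_top|exact: lex1].
Qed.

HB.instance Definition _ X :=
  @Order.POrder_isMeetSemilattice.Build cluster_display (quot_clus X)
    (@quot_inter X) (@quot_leI X).

HB.instance Definition _ X :=
  @Order.hasTop.Build cluster_display (quot_clus X) _ (@quot_lex1 X).

(** The equivalence A ~ top says n <= A for some n in N; by upward closure
    the quotient map kills nothing outside N. *)
Lemma quot_class_top X (A : F X) : quot_class A = \top <-> N X A.
Proof.
split=> [/quot_classP[n nN]|AN]; last first.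
  by apply/quot_classP; exists A; rewrite // meetxx meet1x.
by rewrite meet1x => /meet_idPr; exact: fsub_up.
Qed.

Lemma quot_class_meet X (A B : F X) :
  quot_class (A `&` B) = quot_class A `&` quot_class B.
Proof.
have [n nN An] := quot_reprP A; have [m mN Bm] := quot_reprP B.
apply/quot_classP; exists (n `&` m); first exact: fsub_meet.
by rewrite meetACA -An -Bm meetACA.
Qed.

Definition quot_pull (X Y : C) (f : mor X Y) (b : quot_clus Y) : quot_clus X :=
  quot_class (pull F f (quot_repr b)).

Lemma quot_pull_class (X Y : C) (f : mor X Y) (B : F Y) :
  quot_pull f (quot_class B) = quot_class (pull F f B).
Proof.
have [n nN Bn] := quot_reprP B; apply/quot_classP.
by exists (pull F f n); [exact: fsub_pull|rewrite -!pull_meet Bn].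
Qed.

Definition quot_form : meet_form C.
Proof.
exists (fun X => quot_clus X : tMeetSemilatticeType cluster_display) quot_pull.
- move=> X Y f a b; have [A <-] := quot_class_surj a.
  have [B <-] := quot_class_surj b.
  by rewrite -quot_class_meet !quot_pull_class pull_meet quot_class_meet.
- by move=> X Y f; rewrite quot_pull_class pull_top.
- move=> X a; have [A <-] := quot_class_surj a.
  by rewrite quot_pull_class pull_id.
- move=> X Y Z g f a; have [A <-] := quot_class_surj a.
  by rewrite !quot_pull_class pull_comp.
Defined.

End QuotientForm.

(** * Extensional presentations of a minimal distributivity form *)

Lemma sink_eq (C : category) (F : meet_form C) (X : C) (I : Type)
    (D : I -> C) (A B : forall i, F (D i)) (f g : forall i, mor (D i) X) :
  (forall i, A i = B i) -> (forall i, f i = g i) -> Sink A f = Sink B g.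
Proof.
move=> AB fg; have -> : A = B by exact: functional_extensionality_dep.
by have -> : f = g by exact: functional_extensionality_dep.
Qed.

Section MinimalMorphism.
Variables (C : category) (F : meet_form C) (G : dform C).

(** One-element presentations by an isomorphism are admissible in every
    distributivity form: they arise from a unit presentation by reindexing
    along I -> unit and replacing the source along the isomorphism. *)
Lemma adm_presentation_iso (X : C) (S : sink G X) (U : G X) (i0 : idx S) :
  (forall i, i = i0) -> (forall i, is_iso (leg S i)) ->
  (forall i, lab S i = pull G (leg S i) U) -> adm S U.
Proof.
case: S i0 => [I D A f] /= i0 i0P fi AE.
have bij : bijective (fun _ : I => tt) by exists (fun=> i0) => [i|[]//].
pose T := @reindex_sink C G X (unit_sink U) I (fun=> tt).
have aT : adm T U := @adm_reindex C G X (unit_sink U) U I _ bij (adm_unit U).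
have := @adm_reparam C G X T U D f fi aT.
congr adm; apply: sink_eq => i //=; exact: compm_idl.
Qed.

(** Admissible presentations of the minimal form are mapped to presentations by
    isomorphisms, so preservation of admissibility is automatic. *)
Definition min_dmor (u : forall X : C, F X -> G X)
    (u_nat : forall (X Y : C) (f : mor X Y) (B : F Y),
      u X (pull F f B) = pull G f (u Y B))
    (u_meet : forall (X : C) (A B : F X), u X (A `&` B) = u X A `&` u X B)
    (u_top : forall X : C, u X \top = \top) : dmor (min_dform F) G.
Proof.
exists u => // X S U [i0 [i0P fi AE]].
apply: (@adm_presentation_iso X (map_sink u S) (u X U) i0) => //= i; rewrite (i0P i)//.
by rewrite AE u_nat.
Defined.

End MinimalMorphism.

Section CanonicalSequence.
Variables (C : category) (F : meet_form C) (N : filter_subform F).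

Let K : DFrm C := min_dform (subform N).
Let Q : DFrm C := min_dform (quot_form N).
Let M : DFrm C := min_dform F.

Definition fsub_incl : dmor K M.
Proof. by apply: (@min_dmor C (subform N) M (fun X A => fsub_val A)). Defined.

Definition quot_proj : dmor M Q.
Proof.
apply: (@min_dmor C F Q (fun X A => quot_class N A)) => //.
- by move=> X Y f B; rewrite /= quot_pull_class.
- by move=> X A B; exact: quot_class_meet.
Defined.

Definition filter_sequence : @ext_sequence (DFrm C) M :=
  @ExtSequence (DFrm C) M K fsub_incl Q quot_proj.

Lemma filter_sequence_fibre X : kernel_fibre filter_sequence X = N X.
Proof. by apply/seteqP; split=> A /quot_class_top. Qed.

(** A morphism killed by the quotient takes its values in N. Its corestriction
    preserves admissibility because an admissible presentation of the source
    becomes one by an isomorphism in F, and the labels are the same in the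
    subform. *)
Lemma fsub_incl_kernel : @is_kernel (DFrm C) (@null_mor C) K M Q fsub_incl quot_proj.
Proof.
split=> [X [A AN]|H h]; first exact/quot_class_top.
move: h => /= h hN.
have hN' X (A : (H : dform C) X) : N X (h X A) by apply/quot_class_top; exact: hN.
pose h1 X (A : (H : dform C) X) : subform N X := FsubClus (hN' X A).
have h1E : exists h' : dmor H K, forall X A, h' X A = h1 X A.
  unshelve eexists (@DMor C H K h1 _ _ _ _) => //.
  - by move=> X Y f B; apply: fsub_val_inj; exact: (dmor_nat h).
  - by move=> X A B; apply: fsub_val_inj; exact: (dmor_meet h).
  - by move=> X; apply: fsub_val_inj; exact: (dmor_top h).
  - move=> X S U /(dmor_adm h)[i0 [i0P fi AE]]; exists i0; split=> //=.
    exact: fsub_val_inj.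
have [h' h'E] := h1E; exists h'; split.
  by apply: dmor_ext => X A; rewrite /= h'E.
move=> g gE; apply: dmor_ext => X A; rewrite h'E; apply: fsub_val_inj.
by rewrite /= -gE.
Qed.

(** A morphism h that is top on N satisfies h A = h A /\ h n = h (A /\ n), so it
    is constant on classes. *)
Lemma quot_proj_cokernel : @is_cokernel (DFrm C) (@null_mor C) K M Q fsub_incl quot_proj.
Proof.
split=> [X [A AN]|H h]; first exact/quot_class_top.
move: h => /= h hN.
have hE X (A B : F X) : quot_class N A = quot_class N B -> h X A = h X B.
  move=> /quot_classP[n nN E].
  have hn : h X n = \top by exact: (hN X (FsubClus nN)).
  by rewrite -[LHS]meetx1 -[RHS]meetx1 -hn -!dmor_meet E.
pose h1 X (a : quot_form N X) : (H : dform C) X := h X (quot_repr a).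
have h1E X (A : F X) : h1 X (quot_class N A) = h X A.
  by apply: hE; exact: quot_reprK.
unshelve eexists (@min_dmor C (quot_form N) H h1 _ _ _).
- move=> X Y f b; have [B <-] := quot_class_surj b.
  by rewrite [pull _ _ _]quot_pull_class !h1E; exact: (dmor_nat h).
- move=> X a b; have [A <-] := quot_class_surj a; have [B <-] := quot_class_surj b.
  by rewrite -quot_class_meet !h1E; exact: (dmor_meet h).
- by move=> X; rewrite h1E; exact: (dmor_top h).
split; first by apply: dmor_ext => X A; exact: h1E.
move=> g gE; apply: dmor_ext => X a; have [A <-] := quot_class_surj a.
by rewrite [LHS]h1E -gE.
Qed.

Lemma filter_sequence_exact : @short_exact (DFrm C) (@null_mor C) M filter_sequence.
Proof. by split; [exact: fsub_incl_kernel|exact: quot_proj_cokernel]. Qed.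

End CanonicalSequence.

Lemma filter_subform_ext (C : category) (F : meet_form C) (N N' : filter_subform F) :
  (forall X, N X = N' X) -> N = N'.
Proof.
case: N N' => [N n1 n2 n3 n4] [N' m1 m2 m3 m4] /= E.
have {}E : N = N' by exact: functional_extensionality_dep.
by case: _ / E m1 m2 m3 m4 => *; congr FilterSubform; exact: Prop_irrelevance.
Qed.

Lemma null_mor_comp (C : category) (F G H K : dform C) (w : dmor H K)
    (v : dmor G H) (u : dmor F G) :
  null_mor v -> null_mor (dmor_comp w (dmor_comp v u)).
Proof. by move=> vN X A; rewrite /= vN dmor_top. Qed.

Section Classification.
Variables (C : category) (F : meet_form C).

Let M : DFrm C := min_dform F.
Let Ms : SDFrm C := exist _ M (@min_dform_strong C F).

Definition kernel_filter (s : @ext_sequence (DFrm C) M) : filter_subform F.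
Proof.
pose q : dmor M _ := coker_map s.
exists (kernel_fibre s) => [X|X A B|X A B|X Y f B]; rewrite /kernel_fibre /= -/q.
- exact: dmor_top.
- by move=> qA qB; rewrite [LHS](dmor_meet q) qA qB meetxx.
- move=> qA /meet_idPl AB; have := dmor_meet q A B.
  by rewrite [A `&` B]AB qA meet1x.
- by move=> qB; rewrite [LHS](dmor_nat q) qB pull_top.
Defined.

Lemma sequence_iso_fibre (s t : @ext_sequence (DFrm C) M) :
  sequence_iso s t -> kernel_filter s = kernel_filter t.
Proof.
move=> [_ [b [_ [b' [b'b _]] _ bq]]].
have bq' : compm b' (coker_map t) = coker_map s.
  by rewrite -bq compm_assoc b'b compm_idl.
apply: filter_subform_ext => X; apply/seteqP; split=> A /= qA.
  rewrite /kernel_fibre /= -bq /= [(coker_map s : dmor _ _) X A]qA.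
  exact: (dmor_top (b : dmor _ _)).
rewrite /kernel_fibre /= -bq' /= [(coker_map t : dmor _ _) X A]qA.
exact: (dmor_top (b' : dmor _ _)).
Qed.

(** Since [ker_map s] has its values in the kernel fibres of s, any sequence with
    the same fibres kills it too. *)
Lemma fibre_null (s t : @ext_sequence (DFrm C) M) :
  @null_mor C _ _ (compm (coker_map s) (ker_map s)) ->
  kernel_filter s = kernel_filter t ->
  @null_mor C _ _ (compm (coker_map t) (ker_map s)).
Proof.
move=> sN E X A.
have : kernel_filter s X ((ker_map s : dmor _ _) X A) by exact: sN.
by rewrite E.
Qed.

Lemma dform_sequence_isoP (s t : @ext_sequence (DFrm C) M) :
  @short_exact (DFrm C) (@null_mor C) M s ->
  @short_exact (DFrm C) (@null_mor C) M t ->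
  sequence_iso s t <-> kernel_filter s = kernel_filter t.
Proof.
move=> sE tE; split=> [|E]; first exact: sequence_iso_fibre.
apply: (short_exact_iso sE tE).
- by apply: fibre_null => //; case: tE => -[].
- by apply: fibre_null => //; case: sE => -[].
Qed.

Lemma forget_strong_iso (s t : @ext_sequence (SDFrm C) Ms) :
  sequence_iso s t -> sequence_iso (forget_strong s) (forget_strong t).
Proof. by move=> [a [b [ai bi ak bq]]]; exists a, b. Qed.

Lemma strong_sequence_isoP (s t : @ext_sequence (SDFrm C) Ms) :
  @short_exact (SDFrm C) (@null_strong C) Ms s ->
  @short_exact (SDFrm C) (@null_strong C) Ms t ->
  sequence_iso s t <->
  kernel_filter (forget_strong s) = kernel_filter (forget_strong t).
Proof.
move=> sE tE; split=> [/forget_strong_iso|E]; first exact: sequence_iso_fibre.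
apply: (short_exact_iso sE tE).
- by apply: (@fibre_null (forget_strong t) (forget_strong s)) => //; case: tE => -[].
- by apply: (@fibre_null (forget_strong s) (forget_strong t)) => //; case: sE => -[].
Qed.

Definition strong_filter_sequence (N : filter_subform F) : @ext_sequence (SDFrm C) Ms :=
  @ExtSequence (SDFrm C) Ms
    (exist _ _ (@min_dform_strong C (subform N))) (fsub_incl N)
    (exist _ _ (@min_dform_strong C (quot_form N))) (quot_proj N).

Lemma strong_filter_sequence_exact N :
  @short_exact (SDFrm C) (@null_strong C) Ms (strong_filter_sequence N).
Proof.
exact: (@full_short_exact (DFrm C) (@strong C) (@null_mor C) Ms
  (ker_obj (strong_filter_sequence N)) (coker_obj (strong_filter_sequence N))
  (fsub_incl N) (quot_proj N) (filter_sequence_exact N)).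
Qed.

Lemma filter_sequenceK : cancel (@filter_sequence C F) kernel_filter.
Proof. by move=> N; apply: filter_subform_ext => X; exact: filter_sequence_fibre. Qed.

(** A sequence exact among strong forms is isomorphic to the one built from its
    kernel filter, which is exact among all forms. *)
Lemma forget_strong_exact (s : @ext_sequence (SDFrm C) Ms) :
  @short_exact (SDFrm C) (@null_strong C) Ms s ->
  @short_exact (DFrm C) (@null_mor C) M (forget_strong s).
Proof.
move=> sE; pose N := kernel_filter (forget_strong s).
apply: (@sequence_iso_exact (DFrm C) (@null_mor C) M _ (forget_strong s)
  (filter_sequence N)); last exact: filter_sequence_exact.
  by move=> *; exact: null_mor_comp.
apply: (@forget_strong_iso s (strong_filter_sequence N)).
apply/strong_sequence_isoP => //; first exact: strong_filter_sequence_exact.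
by rewrite [RHS]filter_sequenceK.
Qed.

Lemma ext_presentation_filters :
  exists f : @ext_presentation C M -> filter_subform F, bijective f /\
    forall e s, sval e s <->
      @short_exact (DFrm C) (@null_mor C) M s /\ f e = kernel_filter s.
Proof.
apply: (@presentation_classification (DFrm C) (@null_mor C) M _ kernel_filter
  (@filter_sequence C F)).
- exact: filter_sequence_exact.
- exact: filter_sequenceK.
- exact: dform_sequence_isoP.
Qed.

Lemma strong_ext_presentation_filters :
  exists f : @strong_ext_presentation C Ms -> filter_subform F, bijective f /\
    forall e s, sval e s <->
      @short_exact (SDFrm C) (@null_strong C) Ms s /\
      f e = kernel_filter (forget_strong s).
Proof.
apply: (@presentation_classification (SDFrm C) (@null_strong C) Ms _
  (fun s => kernel_filter (forget_strong s)) strong_filter_sequence).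
- exact: strong_filter_sequence_exact.
- exact: filter_sequenceK.
- exact: strong_sequence_isoP.
Qed.

End Classification.

(** * Linear ring topologies and filters of ideals *)

Import GRing.Theory.
Local Open Scope ring_scope.

Lemma idealN (R : comPzRingType) (I : ideal R) x :
  ideal_set I x -> ideal_set I (- x).
Proof. by rewrite -mulN1r; exact: idealM. Qed.

Lemma idealB (R : comPzRingType) (I : ideal R) x y :
  ideal_set I x -> ideal_set I y -> ideal_set I (x - y).
Proof. by move=> Ix Iy; apply: idealD => //; exact: idealN. Qed.

Lemma topology_on_ext (T : Type) (t t' : topology_on T) : opens t = opens t' -> t = t'.
Proof.
case: t t' => [o o1 o2 o3] [o' p1 p2 p3] /= E.
by case: _ / E p1 p2 p3 => *; congr TopologyOn; exact: Prop_irrelevance.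
Qed.

Lemma ideal_filters_ext (N N' : ideal_filters) : (forall R, N R = N' R) -> N = N'.
Proof.
case: N N' => [N n1 n2 n3 n4] [N' m1 m2 m3 m4] /= E.
have {}E : N = N' by exact: functional_extensionality_dep.
by case: _ / E m1 m2 m3 m4 => *; congr IdealFilters; exact: Prop_irrelevance.
Qed.

Lemma linear_topologies_ext (t t' : linear_topologies) : (forall R, t R = t' R) -> t = t'.
Proof.
case: t t' => [t n1 n2 n3] [t' m1 m2 m3] /= E.
have {}E : t = t' by exact: functional_extensionality_dep.
by case: _ / E m1 m2 m3 => *; congr LinearTopologies; exact: Prop_irrelevance.
Qed.

(** The form in which a linear topology is used throughout: it is uniform in the
    point x, so that it includes the invariance under translation, and it
    serves both for a topology built from a filter and for the open ideals of a
    given topology. *)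
Definition ideal_base (R : comPzRingType) (t : topology_on R) (N : set (ideal R)) :=
  forall (x : R) (A : set R), nbhs (x : tring t) A <->
    exists2 I, N I & forall i, ideal_set I i -> A (x + i).

Section IdealBase.
Variables (R : comPzRingType) (t : topology_on R) (N : set (ideal R)).
Hypothesis tN : ideal_base t N.

Lemma base_nbhs0 I : N I -> nbhs (0 : tring t) I.
Proof. by move=> NI; apply/tN; exists I => // i; rewrite add0r. Qed.

Lemma base_nbhs_coset (x : R) I : N I -> nbhs (x : tring t) [set x + i | i in I].
Proof. by move=> NI; apply/tN; exists I => // i Ii; exists i. Qed.

Lemma base_opens : opens t =
  [set U | forall x, U x -> exists2 I, N I & forall i, ideal_set I i -> U (x + i)].
Proof.
transitivity (@open (tring t)); first by [].
rewrite openE; apply/seteqP; split=> U oU x /oU Ux; exact/tN.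
Qed.

Lemma base_linear : linear_topology t.
Proof.
move=> A /tN[I NI IA]; exists I; split; first exact: base_nbhs0.
by move=> x /IA; rewrite add0r.
Qed.

(** Addition, opposite and multiplication send cosets of an ideal into cosets of
    the same ideal. *)
Lemma base_ring : ring_topology t.
Proof.
split=> [[x y]|x|[x y]] A /tN[I NI IA] /=.
- exists ([set x + i | i in I], [set y + i | i in I]) => /=.
    by split; exact: base_nbhs_coset.
  move=> [_ _] [/= [i Ii <-] [j Ij <-]]; rewrite /= addrACA.
  by apply: IA; exact: idealD.
- apply/tN; exists I => // i Ii /=; rewrite /= opprD; apply: IA; exact: idealN.
- exists ([set x + i | i in I], [set y + i | i in I]) => /=.
    by split; exact: base_nbhs_coset.
  move=> [_ _] [/= [i Ii <-] [j Ij <-]]; rewrite /= mulrDl mulrDr -addrA.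
  apply: IA; apply: idealD; first exact: idealM.
  by rewrite mulrC; exact: idealM.
Qed.

Lemma base_separated :
  separated_topology t <-> forall x, (forall I, N I -> ideal_set I x) -> x = 0.
Proof.
split=> [E x xN|E].
  suff : [set 0] x by [].
  rewrite -[X in X x]E => A /tN[I NI IA]; rewrite -[x]add0r; apply: IA; exact: xN.
apply/seteqP; split=> [x xA|_ -> A /nbhs_singleton//].
by apply: E => I NI; apply: (xA (I : set R)); exact: base_nbhs0.
Qed.

Lemma base_hausdorff : separated_topology t <-> hausdorff_space (tring t).
Proof.
split=> [/base_separated E x y xy|H].
  apply/eqP; rewrite -subr_eq0; apply/eqP; apply: E => I NI.
  (* The cosets of x and y meet, so x and y agree modulo every member I. *)
  have [_ [[i Ii <-] [j Ij E]]] := xy _ _ (base_nbhs_coset x NI) (base_nbhs_coset y NI).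
  suff -> : x - y = j - i by exact: idealB.
  by rewrite -(addrK i x) -E [y + j]addrC addrAC addrK.
apply/base_separated => x xN; apply/esym/(H 0 x) => A B /tN[I NI IA] xB.
exists x; split; last exact: nbhs_singleton xB.
by rewrite -[x]add0r; apply: IA; exact: xN.
Qed.

End IdealBase.

Lemma base_inj (R : comPzRingType) (t t' : topology_on R) (N : set (ideal R)) :
  ideal_base t N -> ideal_base t' N -> t = t'.
Proof. by move=> tN t'N; apply: topology_on_ext; rewrite (base_opens tN) (base_opens t'N). Qed.

(** Translations are continuous, so neighbourhoods of x are translates of
    neighbourhoods of 0, and an ideal that is a neighbourhood of 0 is a
    neighbourhood of each of its points, hence open. *)
Lemma linear_base (R : comPzRingType) (t : topology_on R) :
  ring_topology t -> linear_topology t -> ideal_base t (open_ideals t).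
Proof.
move=> [tD _ _] tL.
have tr (x y : tring t) (A : set R) : nbhs (x + y : tring t) A ->
    nbhs x [set z : R | A (z + y)].
  move=> /(tD (x, y))[[P Q] /= [xP yQ] PQ].
  apply: filterS xP => z Pz; apply: (PQ (z, y)); split=> //=.
  exact: nbhs_singleton yQ.
have I_open (I : ideal R) : nbhs (0 : tring t) I -> open_ideals t I.
  move=> I0; rewrite /open_ideals /= openE => x Ix.
  have : nbhs (x : tring t) [set z : R | ideal_set I (z - x)] by apply: tr; rewrite subrr.
  by apply: filterS => z Iz; rewrite -[z](subrK x); exact: idealD.
move=> x A; split=> [xA|[I oI IA]].
  have /tL[I [I0 IA]] : nbhs (0 : tring t) [set z : R | A (z + x)].
    by apply: tr; rewrite add0r.
  by exists I; [exact: I_open|move=> i Ii; rewrite addrC; exact: IA].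
have : nbhs (x : tring t) [set z : R | ideal_set I (z - x)].
  apply: tr; rewrite subrr; apply: open_nbhs_nbhs; split=> //; exact: ideal0.
by apply: filterS => z /IA; rewrite addrC subrK.
Qed.

Section FilterTopology.
Variable N : ideal_filters.

Definition filter_topology (R : comPzRingType) : topology_on R.
Proof.
exists [set U | forall x, U x -> exists2 I, N R I & forall i, ideal_set I i -> U (x + i)].
- by move=> x _; exists \top%O => //; exact: filt_top.
- move=> U V oU oV x [/oU[I NI IU] /oV[J NJ JV]].
  exists (I `&` J)%O; first exact: filt_meet.
  by move=> i [Ii Ji]; split; [exact: IU|exact: JV].
- move=> J f fo x [j _ /fo[I NI If]]; exists I => // i Ii.
  by exists j => //; exact: If.
Defined.

Lemma filter_topology_base R : ideal_base (filter_topology R) (N R).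
Proof.
move=> x A; split=> [[B [oB Bx BA]]|[I NI IA]].
  by have [I NI IB] := oB x Bx; exists I => // i /IB /BA.
exists [set x + i | i in I]; split.
- move=> _ [i Ii <-]; exists I => // j Ij; rewrite -addrA.
  by exists (i + j) => //; exact: idealD.
- by exists 0; [exact: ideal0|rewrite addr0].
- by move=> _ [i Ii <-]; exact: IA.
Qed.

(** An open ideal is a neighbourhood of 0, so it contains a member of N and is in
    N by upward closure; no ideal beyond those of the filter becomes open. *)
Lemma base_open_ideals (R : comPzRingType) (t : topology_on R) :
  ideal_base t (N R) -> open_ideals t = N R.
Proof.
move=> tN; apply/seteqP; split=> I.
  rewrite /open_ideals /= => oI.
  have /tN[J NJ JI] : nbhs (0 : tring t) I.
    by apply: open_nbhs_nbhs; split=> //; exact: ideal0.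
  apply: filt_up NJ _; apply/asboolP => x /JI; by rewrite add0r.
move=> NI; rewrite /open_ideals /= openE => x Ix; apply/tN.
by exists I => // i; exact: idealD.
Qed.

Lemma filter_topology_continuous (R S : comPzRingType) (f : {rmorphism R -> S}) :
  continuous (f : tring (filter_topology R) -> tring (filter_topology S)).
Proof.
move=> x A /filter_topology_base[J NJ JA].
apply/filter_topology_base; exists (ideal_preim f J); first exact: filt_preim.
by move=> i Ji; rewrite /= rmorphD; exact: JA.
Qed.

Definition filter_topologies : linear_topologies :=
  LinearTopologies (fun R => base_ring (@filter_topology_base R))
    (fun R => base_linear (@filter_topology_base R)) filter_topology_continuous.

End FilterTopology.

Section TopologyFilter.
Variable t : linear_topologies.

Lemma linear_topologies_base (R : comPzRingType) : ideal_base (t R) (open_ideals (t R)).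
Proof. by apply: linear_base; [exact: ltop_ring|exact: ltop_linear]. Qed.

Definition open_ideal_filters : ideal_filters.
Proof.
exists (fun R => open_ideals (t R)).
- by move=> R; exact: openT.
- by move=> R I J oI oJ; exact: openI.
- move=> R I J oI /asboolP IJ; rewrite /open_ideals /= openE => x Jx.
  by apply/linear_topologies_base; exists I => // i /IJ; exact: idealD.
- move=> R S f J oJ.
  have /continuousP fo : continuous (f : tring (t R) -> tring (t S)).
    exact: ltop_continuous.
  exact: (fo (ideal_set J : set (tring (t S)))).
Defined.

End TopologyFilter.

Lemma filter_topologiesK : cancel filter_topologies open_ideal_filters.
Proof.
move=> N; apply: ideal_filters_ext => R; apply: base_open_ideals.
exact: filter_topology_base.
Qed.

Lemma open_ideal_filtersK : cancel open_ideal_filters filter_topologies.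
Proof.
move=> t; apply: linear_topologies_ext => R.
apply: (base_inj (@filter_topology_base (open_ideal_filters t) R)).
exact: linear_topologies_base.
Qed.

Lemma filter_topologies_bij : bijective filter_topologies.
Proof. exact: Bijective filter_topologiesK open_ideal_filtersK. Qed.

(** * The ideal form *)

Definition ideal_filters_of (N : filter_subform Idl) : ideal_filters :=
  @IdealFilters N (fsub_top N) (@fsub_meet _ _ N) (@fsub_up _ _ N)
    (@fsub_pull _ _ N).

Definition subform_of (N : ideal_filters) : filter_subform Idl :=
  @FilterSubform CRing Idl N (filt_top N) (@filt_meet N) (@filt_up N)
    (@filt_preim N).

Lemma ideal_filters_of_bij : bijective ideal_filters_of.
Proof. by exists subform_of => -[]. Qed.

Definition ideal_zero (R : comPzRingType) : ideal R.
Proof.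
by exists [set 0] => [//|x y -> ->|a x ->]; rewrite /= ?addr0 ?mulr0.
Defined.

Definition ideal_bigcap (R : comPzRingType) (N : set (ideal R)) : ideal R.
Proof.
exists (\bigcap_(I in N) ideal_set I) => [I _|x y xN yN I NI|a x xN I NI].
- exact: ideal0.
- by apply: idealD; [exact: xN|exact: yN].
- by apply: idealM; exact: xN.
Defined.

(** The ideals below every member of a family are those contained in its
    intersection, which is itself an ideal; so the least ideal is the greatest
    lower bound exactly when the intersection is zero. *)
Lemma hausdorff_objectP (s : @ext_sequence (DFrm CRing) Idl_min)
    (R : comPzRingType) :
  hausdorff_object s R <->
  forall x : R, (forall I, kernel_fibre s R I -> ideal_set I x) -> x = 0.
Proof.
split=> [[bot bot0 [_ botG]] x xN|sep].
  have /asboolP botx := botG (ideal_bigcap (kernel_fibre s R))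
    (fun I NI => introT (asboolP _) (fun y yN => yN I NI)).
  have /asboolP x0 := bot0 (ideal_zero R) Logic.I.
  by apply: x0; apply: botx.
exists (ideal_zero R) => [I _|].
  by apply/asboolP => x ->; exact: ideal0.
split=> [I _|J JN]; apply/asboolP => x; first by move=> ->; exact: ideal0.
by move=> Jx; apply: sep => I /JN /asboolP; apply.
Qed.

Theorem theorem3p10 :
  exists (topo : ext_presentation Idl_min -> linear_topologies)
         (fib : ext_presentation Idl_min -> ideal_filters)
         (incl : strong_ext_presentation Idl_min_strong ->
                 ext_presentation Idl_min),
  [/\ bijective topo, bijective fib, bijective incl,
      forall (e : strong_ext_presentation Idl_min_strong)
        (s : @ext_sequence (SDFrm CRing) Idl_min_strong),
        sval e s -> sval (incl e) (forget_strong s)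
    & forall (e : ext_presentation Idl_min)
        (s : @ext_sequence (DFrm CRing) Idl_min) (R : comPzRingType),
        sval e s ->
        [/\ fib e R = kernel_fibre s R,
            kernel_fibre s R = open_ideals (topo e R),
            hausdorff_object s R <-> separated_topology (topo e R)
          & separated_topology (topo e R) <-> hausdorff_space (tring (topo e R))]].
Proof.
have [f [f_bij fP]] := ext_presentation_filters Idl.
have [g [g_bij gP]] := strong_ext_presentation_filters Idl.
have [f' fK f'K] := f_bij.
have fib_bij := bij_comp ideal_filters_of_bij f_bij.
exists (filter_topologies \o (ideal_filters_of \o f)), (ideal_filters_of \o f),
  (f' \o g); split=> //.
- exact: bij_comp filter_topologies_bij fib_bij.
- by apply: bij_comp g_bij; exists f.
- move=> e s /gP[sE ge]; apply/fP; split; first exact: forget_strong_exact.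
  by rewrite /= f'K ge.
move=> e s R /fP[_ fe].
have fE : ideal_filters_of (f e) R = kernel_fibre s R by rewrite fe.
have base := @filter_topology_base (ideal_filters_of (f e)) R.
split=> //.
- by rewrite -fE; apply/esym; exact: base_open_ideals base.
- by rewrite hausdorff_objectP -fE; apply: iff_sym; exact: base_separated base.
- exact: base_hausdorff base.
Qed.
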